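(* Let $D$ be an eulerian digraph with $m$ arcs and $n$ vertices, in which exactly $\ell$ of the vertices have degree congruent to $0$ mod $4$. Let $T$ be a given directed euler circuit of $D$. Then there exists an orientable directed embedding of $D$ with one proface bounded by $T$ and at most $\ell+1$ antifaces. Consequently, the maximum genus of an orientable directed embedding of $D$ is at least $(m-n-\ell)/2$.
   Context: Digraphs are finite and may have loops and multiple arcs. The degree of a vertex in a digraph is its total degree (indegree plus outdegree). A digraph is eulerian if it has a directed circuit (closed directed trail) using every arc and every vertex; a directed euler circuit is such a circuit. All embeddings are cellular embeddings in closed surfaces. A directed embedding of a digraph is an embedding in which every face is bounded by a directed closed walk (respecting arc directions). In an orientable directed embedding with a fixed orientation of the surface, a face is a proface if its facial directed walk is clockwise and an antiface if it is anticlockwise. *)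

(* Defs.v *)
From mathcomp Require Import all_boot all_order all_algebra all_fingroup.

Set Implicit Arguments.
Unset Strict Implicit.
Unset Printing Implicit Defensive.

(* Loops and multiple arcs are allowed. *)
Record digraph := Digraph {
  vertex : finType;
  darc : finType;
  src : darc -> vertex;
  tgt : darc -> vertex
}.

Definition degree (D : digraph) (x : vertex D) : nat :=
  #|[set a : darc D | src a == x]| + #|[set a : darc D | tgt a == x]|.

Fixpoint diwalk (D : digraph) (x : vertex D) (s : seq (darc D)) (y : vertex D)
    : bool :=
  if s is a :: s' then (src a == x) && diwalk (tgt a) s' y else x == y.

(* A closed trail is given by a base vertex and a sequence of arcs, so that the
   trivial circuit (no arcs) still uses its base vertex. *)
Definition euler_circuit (D : digraph) (x : vertex D) (s : seq (darc D)) : Prop :=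
  [/\ diwalk x s x,
      uniq s,
      forall a : darc D, a \in s
    & forall y : vertex D, y \in x :: [seq tgt a | a <- s]].

Definition eulerian (D : digraph) : Prop :=
  exists (x : vertex D) (s : seq (darc D)), euler_circuit x s.

(* Cellular embeddings of a connected digraph in oriented closed surfaces are
   encoded by rotation systems.  The dart (a, true) is the tail end of the arc
   a, and also stands for a traversed along its direction; (a, false) is the
   head end of a, and stands for a traversed against its direction. *)
Definition dart (D : digraph) : finType := (darc D * bool)%type.

Definition dart_vertex (D : digraph) (d : dart D) : vertex D :=
  if d.2 then src d.1 else tgt d.1.

Definition flip (D : digraph) (d : dart D) : dart D := (d.1, ~~ d.2).

Lemma flip_inj (D : digraph) : injective (@flip D).
Proof. by move=> [a b] [a' b'] [-> /negb_inj ->]. Qed.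

(* r d is the dart following d in the anticlockwise order around its vertex. *)
Definition rotation_system (D : digraph) (r : {perm dart D}) : bool :=
  [forall d, porbit r d == [set e | dart_vertex e == dart_vertex d]].

(* Traverse an arc, then take the next dart anticlockwise around the vertex
   reached: the face stays on the right, so that the orbits of this permutation
   are the face boundaries, each traced clockwise. *)
Definition face_perm (D : digraph) (r : {perm dart D}) : {perm dart D} :=
  (perm (@flip_inj D) * r)%g.

(* A connected digraph without arcs is a single vertex on the sphere: it has
   one face, whose boundary walk traverses no arc. *)
Definition faces (D : digraph) (r : {perm dart D}) : {set {set dart D}} :=
  if #|darc D| == 0 then [set set0] else porbits (face_perm r).

Definition profaces (D : digraph) (r : {perm dart D}) : {set {set dart D}} :=
  [set F in faces r | [forall d in F, d.2]].

(* The clockwise boundary walk runs against every arc, i.e. the directed facial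
   walk is anticlockwise. *)
Definition antifaces (D : digraph) (r : {perm dart D}) : {set {set dart D}} :=
  [set F in faces r | [forall d in F, ~~ d.2]].

Definition directed_embedding (D : digraph) (r : {perm dart D}) : bool :=
  rotation_system r &&
  [forall F in faces r, (F \in profaces r) || (F \in antifaces r)].

(* The clockwise boundary walk of F is the cyclic sequence s of arcs, each
   traversed along its direction. *)
Definition bounded_clockwise_by (D : digraph) (r : {perm dart D})
    (F : {set dart D}) (s : seq (darc D)) : Prop :=
  let w : seq (dart D) := [seq (a, true) | a <- s] in
  [/\ fcycle (face_perm r) w, uniq w & F = [set d in w]].

Definition euler_char (D : digraph) (r : {perm dart D}) : int :=
  (#|vertex D|%:Z - #|darc D|%:Z + #|faces r|%:Z)%R.

(* The g such that euler_char r = 2 - 2 g; rational-valued so that no rounding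
   or truncation takes place. *)
Definition genus (D : digraph) (r : {perm dart D}) : rat :=
  ((2%:R - (euler_char r)%:~R) / 2%:R)%R.

Definition is_max_directed_genus (D : digraph) (g : rat) : Prop :=
  (exists2 r : {perm dart D}, directed_embedding r & genus r = g) /\
  (forall r : {perm dart D}, directed_embedding r -> (genus r <= g)%R).

(* Main.v *)
Require Import Defs.
From mathcomp Require Import all_boot all_order all_algebra all_fingroup.
From mathcomp Require Import lra.

(** A directed embedding amounts to two permutations of the arcs, [p] (the next
    arc on the proface) and [q] (the next arc on the antiface), such that the
    orbits of [a |-> p (q a)] are exactly the sets of arcs leaving a common
    vertex.  With [p] the successor in [T], one seeks a permutation [c] cyclic
    on each such set for which [p^-1 \o c] has few orbits.  A cycle of length
    [k] on a given set is a product of 3-cycles, times one transposition when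
    [k] is even.  Each 3-cycle may be inverted, and one of the two choices does
    not increase the number of orbits, while a transposition adds at most one.
    So only the vertices of even outdegree, i.e. of degree divisible by 4, cost
    an orbit. *)

(** * Permutations that are cyclic on a set *)

Lemma porbit_closed {T : finType} {s : {perm T}} {A : pred T} {x : T} :
  {homo s : y / A y} -> A x -> {in porbit s x, forall y, A y}.
Proof.
move=> sA Ax _ /porbitP [i ->]; rewrite permX.
by elim: i => //= i IHi; apply: sA.
Qed.

Lemma porbit_step {T : finType} (s : {perm T}) (x y : T) :
  y \in porbit s x -> s y \in porbit s x.
Proof.
by rewrite -!eq_porbit_mem -[s y]/((s ^+ 1)%g y) porbit_perm.
Qed.

Lemma porbit_trans {T : finType} {s : {perm T}} {x y z : T} :
  x \in porbit s y -> y \in porbit s z -> x \in porbit s z.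
Proof. by rewrite -!eq_porbit_mem => /eqP ->. Qed.

Lemma porbit_fconnect {T : finType} (s : {perm T}) (x y : T) :
  (y \in porbit s x) = fconnect s x y.
Proof.
apply/porbitP/idP => [[i ->]|sxy]; first by rewrite permX fconnect_iter.
by exists (findex s x y); rewrite permX iter_findex.
Qed.

(** Nothing is required of [c] outside [B], so one permutation can be cyclic on all fibres of a map
    at once. *)
Definition cyclic_on {T : finType} (c : {perm T}) (B : {set T}) : Prop :=
  {in B, forall x, porbit c x = B}.

Lemma cyclic_on_mem {T : finType} {c : {perm T}} {B : {set T}} {x : T} :
  cyclic_on c B -> x \in B -> c x \in B.
Proof.
move=> cB xB; rewrite -(cB x xB); apply: porbit_step; exact: porbit_id.
Qed.

Lemma cyclic_on_eq {T : finType} {c c' : {perm T}} {B : {set T}} :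
  {in B, c =1 c'} -> cyclic_on c B -> cyclic_on c' B.
Proof.
move=> eqc cB x xB; rewrite -(cB x xB); apply/setP => y.
suff eqX i : ((c ^+ i) x = (c' ^+ i) x)%g.
  by apply/porbitP/porbitP => -[i ->]; exists i; rewrite eqX.
elim: i => [|i IHi]; first by rewrite !expg0.
rewrite !expgSr !permM -IHi eqc //.
by rewrite -(cB x xB) mem_porbit.
Qed.

(** The product applies [tperm a z] first, so it sends [z] to [a] and [a] to [c z]: the point [a] is
    inserted into the cycle right after [z]. *)
Lemma cyclic_on_attach {T : finType} {c : {perm T}} {B : {set T}} {a z : T} :
  perm_on B c -> cyclic_on c B -> z \in B -> a \notin B ->
  perm_on (a |: B) (tperm a z * c)%g /\ cyclic_on (tperm a z * c)%g (a |: B).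
Proof.
move=> onB cB zB aB.
have naB x : x \in B -> x != a by apply: contraTneq => ->.
have ca : c a = a by apply: out_perm onB aB.
have c1a : (tperm a z * c)%g a = c z by rewrite permM tpermL.
have c1z : (tperm a z * c)%g z = a by rewrite permM tpermR.
have c1x x : x != a -> x != z -> (tperm a z * c)%g x = c x.
  by move=> xa xz; rewrite permM tpermD // eq_sym.
have on1 : perm_on (a |: B) (tperm a z * c)%g.
  apply/subsetP => x; rewrite unfold_in in_setU1; apply: contraR.
  rewrite negb_or => /andP [xa xB]; rewrite c1x //; first by rewrite (out_perm onB).
  by apply: contraNneq xB => ->.
split=> // x xaB; move: on1 c1a c1z c1x.
set c1 := (tperm a z * c)%g => on1 c1a c1z c1x.
have zall y : y \in a |: B -> y \in porbit c1 z.
  case/setU1P => [->|]; first by rewrite -c1z porbit_step ?porbit_id.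
  rewrite -(cB z zB) => yz.
  pose A := [pred t | (t \in B) && (t \in porbit c1 z)].
  suff: A y by case/andP.
  apply: (porbit_closed _ _ y yz) => [t /andP [tB tz]|/=]; last by rewrite zB porbit_id.
  rewrite /= (cyclic_on_mem cB tB) /=.
  have [->|ntz] := eqVneq t z.
    by rewrite -c1a -c1z !porbit_step ?porbit_id.
  by rewrite -c1x ?naB // porbit_step.
apply/setP => y; apply/idP/idP => [|yaB].
  apply: (porbit_closed (A := mem (a |: B))) => [t|//].
  by rewrite /= (perm_closed _ on1).
by apply: porbit_trans (zall y yaB) _; rewrite porbit_sym zall.
Qed.

(** * Orbit counts under transpositions and 3-cycles *)

Lemma porbits_tperm_le {T : finType} (s : {perm T}) (x y : T) :
  #|porbits (tperm x y * s)%g| <= #|porbits s|.+1.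
Proof.
rewrite -addn1; apply: leq_trans (leq_addr (x \notin porbit s y).*2 _) _.
by rewrite porbits_mul_tperm leq_add2l leq_b1.
Qed.

Lemma porbits_tperm_merge {T : finType} {s : {perm T}} {x y : T} :
  x \notin porbit s y -> #|porbits (tperm x y * s)%g| < #|porbits s|.
Proof.
move=> xy; have := porbits_mul_tperm s x y; rewrite /= xy /= addn2.
case: eqP xy => [->|_ _]; first by rewrite porbit_id.
by rewrite addn1 => -[->].
Qed.

(* The two choices multiply [s] by the two 3-cycles on [a], [b] and [z].
   If [tperm a z] splits an orbit of [s], then [a] and [z] end up in distinct
   orbits, one of which avoids [b] and is merged with that of [b]. *)
Lemma porbits_3cycle_le {T : finType} (s : {perm T}) {a : T} (b : T) {z : T} :
  a != z ->
  exists2 w, w = a \/ w = z &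
    #|porbits (tperm b w * (tperm a z * s))%g| <= #|porbits s|.
Proof.
move=> naz; set s1 := (tperm a z * s)%g.
have [s1az|] := boolP (a \in porbit s1 z); last first.
  move=> naz1; have [ba|nba] := boolP (b \in porbit s1 a).
    exists z; first by right.
    have nbz : b \notin porbit s1 z.
      apply: contra naz1 => bz; rewrite porbit_sym in ba.
      exact: porbit_trans ba bz.
    by rewrite -ltnS (leq_trans (porbits_tperm_merge nbz)) // porbits_tperm_le.
  exists a; first by left.
  by rewrite -ltnS (leq_trans (porbits_tperm_merge nba)) // porbits_tperm_le.
(* Now [tperm a z * s1] is [s] and splits an orbit of [s1], so [s1] has exactly one orbit fewer than
   [s]; this pays for any second transposition. *)
exists a; first by left.
apply: leq_trans (porbits_tperm_le _ _ _) _.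
have := porbits_mul_tperm s1 a z.
rewrite /= s1az naz /= addn0 addn1 /s1 mulgA tperm2 mul1g => <-.
exact: leqnn.
Qed.

(** Strong induction on the size of [B], removing one point when it is even and two when it is odd.
    An arbitrary [s] lets the result be applied to one fibre after another. *)
Lemma exists_cyclic_on {T : finType} (s : {perm T}) (B : {set T}) :
  exists c : {perm T}, [/\ perm_on B c, cyclic_on c B
    & #|porbits (c * s)%g| <= #|porbits s| + ~~ odd #|B|].
Proof.
have [n] := ubnP #|B|; elim: n B => // n IHn B leBn.
have [B0|[a aB]] := set_0Vmem B.
  exists 1%g; split; first exact: perm_on1.
    by move=> x; rewrite B0 inE.
  by rewrite mul1g leq_addr.
have cardB := cardsD1 a B; rewrite aB add1n in cardB.
have [B1|[z zB]] := set_0Vmem (B :\ a).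
  exists 1%g; split; first exact: perm_on1.
    have -> : B = [set a] by rewrite -(setD1K aB) B1 setU0.
    move=> x /set1P ->; apply/setP => y; rewrite in_set1.
    apply/idP/eqP => [/porbitP [i ->]|->]; last exact: porbit_id.
    by rewrite expg1n perm1.
  by rewrite mul1g leq_addr.
have naz : a != z by move: zB; rewrite in_setD1 eq_sym => /andP [].
(* Removing [a] leaves an odd set, which costs nothing; reattaching [a] costs at most the one orbit
   allowed. *)
have [evenB|oddB] := boolP (~~ odd #|B|).
  have [|c [onc cc le_c]] := IHn (B :\ a); first by rewrite -ltnS -cardB.
  have aBa : a \notin B :\ a by rewrite setD11.
  have [] := cyclic_on_attach onc cc zB aBa.
  rewrite setD1K // => on1 c1; exists (tperm a z * c)%g; split=> //.
  move: evenB le_c; rewrite cardB /= negbK => -> /=; rewrite addn0 addn1 -mulgA => le_c.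
  by apply: leq_trans (porbits_tperm_le _ _ _) _.
have [Bz|[b bB]] := set_0Vmem (B :\ a :\ z).
  by move: oddB; rewrite cardB (cardsD1 z) zB Bz cards0.
have cardB1 := cardsD1 b (B :\ a).
have bBa : b \in B :\ a by move: bB; rewrite in_setD1 => /andP [].
have nzb : z != b by move: bB; rewrite in_setD1 eq_sym => /andP [].
rewrite bBa add1n in cardB1.
have [|c [onc cc le_c]] := IHn (B :\ a :\ b).
  by move: leBn; rewrite cardB cardB1 ltnS => /ltnW.
have zB2 : z \in B :\ a :\ b by rewrite in_setD1 nzb.
have aB2 : a \notin B :\ a :\ b by rewrite !inE eqxx /= andbF.
have [on1 c1] := cyclic_on_attach onc cc zB2 aB2.
(* Once [a] is inserted after [z], the point [b] may go after [a] or after [z]; both give a cycle on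
   [B], so [w] is free to be the choice that adds no orbit. *)
have [w wP le_w] := porbits_3cycle_le (c * s) b naz.
have wB : w \in a |: (B :\ a :\ b).
  by case: wP => ->; rewrite in_setU1 ?eqxx // zB2 orbT.
have nba : b != a by move: bBa; rewrite in_setD1 => /andP [].
have bB2 : b \notin a |: (B :\ a :\ b) by rewrite !inE (negbTE nba) eqxx.
have [] := cyclic_on_attach on1 c1 wB bB2.
rewrite setUCA setD1K // setD1K // => on2 c2.
exists (tperm b w * (tperm a z * c))%g; split=> //.
rewrite cardB cardB1 /= negbK in oddB; rewrite (negbTE oddB) in le_c.
by rewrite -!mulgA; apply: leq_trans le_w le_c.
Qed.

Lemma exists_cyclic_on_fibers {T V : finType} (f : T -> V) (s : {perm T}) :
  exists2 c : {perm T},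
    forall v, cyclic_on c [set x | f x == v]
  & #|porbits (c * s)%g|
      <= #|porbits s| + #|[set v | ~~ odd #|[set x | f x == v]|]|.
Proof.
suff [c [fc _ le_c]] : exists c : {perm T},
    [/\ {in enum V, forall v, cyclic_on c [set x | f x == v]},
        forall x, f x \notin enum V -> c x = x
      & #|porbits (c * s)%g|
          <= #|porbits s| + \sum_(v <- enum V) ~~ odd #|[set x | f x == v]|].
  exists c => [v|]; first by apply: fc; rewrite mem_enum.
  apply: leq_trans le_c _; rewrite big_enum /= -sum1dep_card leq_add2l.
  by rewrite [leqRHS]big_mkcond; apply: leq_sum => v _; case: odd.
elim: (enum V) (enum_uniq V) => [|v e IHe] /=.
  by move=> _; exists 1%g; split=> // [x|]; rewrite ?perm1 // mul1g leq_addr.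
case/andP => ve /IHe [c [fc idc le_c]].
have [cv [oncv ccv le_cv]] := exists_cyclic_on (c * s) [set x | f x == v].
(* The factor [cv] acts first and moves only the fibre of [v], on which [c] is still the identity;
   the fibres treated earlier see only [c]. *)
exists (cv * c)%g; split.
- move=> w; rewrite inE => /predU1P [->|we].
    apply: (cyclic_on_eq _ ccv) => x xv; rewrite permM idc //.
    by have := cyclic_on_mem ccv xv; rewrite inE => /eqP ->.
  apply: cyclic_on_eq (fc w we) => x; rewrite inE permM => /eqP fx.
  rewrite (out_perm oncv) // inE fx.
  by apply: contraNneq ve => <-.
- move=> x; rewrite inE negb_or => /andP [xv xe].
  by rewrite permM (out_perm oncv) ?inE // idc.
by rewrite -mulgA big_cons addnCA addnC (leq_trans le_cv) // leq_add2r.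
Qed.

(** * Closed diwalks, and embeddings built from two arc permutations *)

Lemma diwalk_path (D : digraph) (x y : vertex D) (a : darc D) (s : seq (darc D)) :
  diwalk x (a :: s) y =
    [&& src a == x, path (fun b c => src c == tgt b) a s & tgt (last a s) == y].
Proof. by elim: s x a => [|b s IHs] x a //=; have /= -> := IHs (tgt a) b; rewrite !andbA. Qed.

Lemma closed_diwalk_cycle {D : digraph} {x : vertex D} {s : seq (darc D)} :
  diwalk x s x -> path.cycle (fun b c => src c == tgt b) s.
Proof.
case: s => // a s; rewrite diwalk_path /= rcons_path.
by case/and3P => /eqP -> -> /eqP ->; rewrite eqxx.
Qed.

Section TwoSidedPerm.
Context {D : digraph}.
Implicit Types p q : {perm darc D}.

Lemma two_sided_inj p q :
  injective (fun d : dart D => ((if d.2 then p d.1 else q d.1), d.2)).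
Proof. by move=> [a []] [b []] //= [] /perm_inj ->. Qed.

(* The boundaries of the profaces are the orbits of [p] and those of the
   antifaces are the orbits of [q]. *)
Definition two_sided p q : {perm dart D} := perm (@two_sided_inj p q).

Lemma porbit_two_sided p q (a : darc D) (b : bool) :
  porbit (two_sided p q) (a, b) = [set (c, b) | c in porbit (if b then p else q) a].
Proof.
have iterE i : ((two_sided p q ^+ i) (a, b) =
    (((if b then p else q) ^+ i) a, b))%g.
  elim: i => [|i IHi]; first by rewrite !expg0 !perm1.
  by rewrite !expgSr !permM IHi permE /=; case: b {IHi}.
apply/setP => d; apply/porbitP/imsetP => [[i ->]|[_ /porbitP [i ->] ->]].
  by rewrite iterE; eexists; first exact: mem_porbit.
by exists i; rewrite iterE.
Qed.

(** The solution [r] of [face_perm r = two_sided p q]. *)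
Definition rotation p q : {perm dart D} := ((perm (@flip_inj D))^-1 * two_sided p q)%g.

Lemma face_perm_rotation p q : face_perm (rotation p q) = two_sided p q.
Proof. by rewrite /face_perm /rotation mulKVg. Qed.

Lemma rotationE p q (d : dart D) :
  rotation p q d = two_sided p q (flip d).
Proof.
have flipK : cancel (@flip D) (@flip D) by case=> a b; rewrite /flip /= negbK.
rewrite permM; congr (two_sided _ _ _); apply: (@perm_inj _ (perm (@flip_inj D))).
by rewrite permKV permE flipK.
Qed.

(** Tail and head darts alternate around a vertex: [(a, true)] is followed by [(q a, false)], then
    by [(p (q a), true)]. Two steps thus act as [q * p] on the tail darts, and each head dart is one
    step from a tail dart. *)
Lemma rotation_system_rotation p q :
  (forall a, src (p a) = tgt a) ->
  (forall v, cyclic_on (q * p)%g [set a | src a == v]) ->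
  rotation_system (rotation p q).
Proof.
move=> src_p cyc; set r := rotation p q.
have rt a : r (a, true) = (q a, false) by rewrite /r rotationE permE.
have rf a : r (a, false) = (p a, true) by rewrite /r rotationE permE.
have tgt_q a : tgt (q a) = src a.
  have /= := cyclic_on_mem (cyc (src a)) (x := a).
  by rewrite !inE eqxx permM src_p => /(_ isT)/eqP.
have rv d : dart_vertex (r d) = dart_vertex d.
  by case: d => a []; rewrite ?rt ?rf /dart_vertex /=.
have true_orbit a b : src a = src b -> (b, true) \in porbit r (a, true).
  move=> ab; have: b \in porbit (q * p)%g a.
    by rewrite (cyc (src a)) inE ?ab.
  pose A := [pred c | (c, true) \in porbit r (a, true)].
  move=> ba; suff: A b by [].
  apply: (porbit_closed _ _ b ba) => [c|] /=; last exact: porbit_id.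
  by rewrite permM -rf -rt => ca; do 2 apply: porbit_step.
have to_true d : exists2 a, src a = dart_vertex d & (a, true) \in porbit r d.
  case: d => a [] /=; first by exists a; last exact: porbit_id.
  by exists (p a); rewrite ?src_p // -rf porbit_step ?porbit_id.
apply/forallP => d; apply/eqP/setP => e; rewrite inE; apply/idP/eqP => [ed|ed].
  apply/eqP; pose A := [pred e' | dart_vertex e' == dart_vertex d].
  suff: A e by [].
  by apply: (porbit_closed _ _ e ed) => [c|] /=; rewrite ?rv.
have [a ad da] := to_true d; have [b be eb] := to_true e.
apply: porbit_trans da; rewrite porbit_sym.
apply: porbit_trans eb; rewrite porbit_sym; apply: true_orbit.
by rewrite ad be.
Qed.

Lemma directed_embedding_rotation p q :
  rotation_system (rotation p q) -> directed_embedding (rotation p q).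
Proof.
move=> rs; rewrite /directed_embedding rs; apply/forall_inP => F FF.
rewrite !inE FF /=; move: FF; rewrite /faces.
case: ifP => _.
  by rewrite inE => /eqP ->; apply/orP; left; apply/forall_inP => d; rewrite inE.
case/imsetP => -[a b] _ ->; rewrite face_perm_rotation porbit_two_sided.
by case: b; apply/orP; [left|right]; apply/forall_inP => _ /imsetP [c _ ->].
Qed.

(** The 1 covers the arcless digraph, whose empty face is vacuously an antiface although [q] has no
    orbit. *)
Lemma card_antifaces_rotation p q :
  #|antifaces (rotation p q)| <= maxn 1 #|porbits q|.
Proof.
have [D0|D0] := boolP (#|darc D| == 0).
  rewrite leq_max; apply/orP; left; rewrite -(cards1 (set0 : {set dart D})).
  by apply/subset_leq_card/subsetP => F; rewrite inE /faces D0 => /andP [].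
rewrite leq_max; apply/orP; right.
apply: leq_trans (leq_imset_card (fun O : {set darc D} => [set (c, false) | c in O]) _).
apply/subset_leq_card/subsetP => F; rewrite inE /faces (negbTE D0) => /andP [].
case/imsetP => -[a b] _ ->; rewrite face_perm_rotation => /forall_inP /(_ _ (porbit_id _ _)).
case: b => //= _; rewrite porbit_two_sided; apply: imset_f; exact: imset_f.
Qed.

End TwoSidedPerm.

(** * The embedding extending an Euler circuit, and its genus *)

Lemma card_faces {D : digraph} {r : {perm dart D}} :
  directed_embedding r -> #|faces r| <= #|profaces r| + #|antifaces r|.
Proof.
case/andP => _ /forall_inP sides; apply: leq_trans (leq_card_setU _ _).
by apply/subset_leq_card/subsetP => F FF; rewrite in_setU sides.
Qed.

Lemma circuit_succ_inj {T : eqType} {s : seq T} : uniq s -> injective (next s).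
Proof. by move=> Us; apply: can_inj (prev_next Us). Qed.

(** The bijection [p] carries the arcs entering [v] to those leaving it. Hence 4 divides the degree
    exactly when the outdegree is even. *)
Lemma degree_fibers {D : digraph} {p : {perm darc D}} (v : vertex D) :
  (forall a, src (p a) = tgt a) ->
  degree v = #|[set a : darc D | src a == v]|.*2.
Proof.
move=> src_p; rewrite /degree -addnn; congr (_ + _).
rewrite -[RHS](card_imset _ (@perm_inj _ p^-1)%g); apply: eq_card => a.
rewrite inE; apply/idP/imsetP => [av|[b]].
  by exists (p a); rewrite ?permK // inE src_p.
by rewrite inE => bv ->; rewrite -src_p permKV.
Qed.

Lemma euler_embedding (D : digraph) (x : vertex D) (s : seq (darc D)) :
  euler_circuit x s ->
  exists r : {perm dart D},
    [/\ directed_embedding r,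
        exists2 F : {set dart D}, profaces r = [set F] & bounded_clockwise_by r F s
      & #|antifaces r| <= #|[set v : vertex D | degree v == 0 %[mod 4]]| + 1].
Proof.
case=> walk_s Us all_s _.
pose p := perm (circuit_succ_inj Us).
have src_p a : src (p a) = tgt a.
  rewrite permE; apply/eqP.
  exact: (next_cycle (closed_diwalk_cycle walk_s) (all_s a)).
have cyc_p : fcycle p s.
  by rewrite (eq_cycle (e' := frel (next s))) ?cycle_next // => a b; rewrite /= permE.
have p_orbit a b : b \in porbit p a.
  by rewrite porbit_fconnect (fconnect_cycle cyc_p) ?all_s.
have [c cyc_c le_c] := exists_cyclic_on_fibers (@src D) p^-1%g.
(* This makes [q * p] equal to [c], cyclic at every vertex, while [le_c] bounds the orbits of
   [q]. *)
pose q := (c * p^-1)%g; pose r := rotation p q.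
have emb : directed_embedding r.
  apply/directed_embedding_rotation/rotation_system_rotation => // v.
  by rewrite /q mulgKV.
exists r; split=> //.
  exists [set d in [seq (a, true) | a <- s]]; last first.
    split=> //; last by rewrite map_inj_uniq // => a b [].
    rewrite /r face_perm_rotation cycle_map.
    by rewrite (eq_cycle (e' := frel p)) // => a b; rewrite /= permE /= xpair_eqE eqxx andbT.
  have -> : [set d in [seq (a, true) | a <- s]] = [set d : dart D | d.2].
    apply/setP => -[a b]; rewrite !inE /=; apply/mapP/idP => [[c' _ [_ ->]] //|].
    by case: b => // _; exists a; rewrite ?all_s.
  (* Without arcs, the only face is empty: it is vacuously a proface and equals the set of all tail
     darts. *)
  apply/setP => F; rewrite !inE /faces; have [D0|D0] := boolP (_ == 0).
    have noarc (a : darc D) : False by move/eqP/card0_eq: D0 => /(_ a).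
    rewrite inE.
    have -> : [set d : dart D | d.2] = set0 by apply/setP => -[a]; case: (noarc a).
    by apply: andb_idr => _; apply/forall_inP => -[a]; case: (noarc a).
  have trueE a : porbit (face_perm r) (a, true) = [set d | d.2].
    rewrite face_perm_rotation porbit_two_sided; apply/setP => -[b e].
    rewrite inE /=; apply/imsetP/idP => [[c' _ [_ ->]] //|].
    by case: e => // _; exists b.
  apply/andP/eqP => [[/imsetP [[a b] _ ->]]|->].
    move/forall_inP => /(_ _ (porbit_id _ _)); case: b => //= _; exact: trueE.
  split; last by apply/forall_inP => d; rewrite inE.
  have /card_gt0P [a _] : 0 < #|darc D| by rewrite lt0n.
  by rewrite -(trueE a) imset_f.
have porbits_p : #|porbits p| <= 1.
  apply/card_le1_eqP => _ _ /imsetP [a _ ->] /imsetP [b _ ->].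
  by apply/eqP; rewrite eq_porbit_mem.
apply: leq_trans (card_antifaces_rotation _ _) _.
rewrite geq_max leq_addl /=; apply: leq_trans le_c _.
rewrite porbitsV addnC leq_add //; apply: eq_leq; apply: eq_card => v.
rewrite !inE (degree_fibers v src_p) mod0n -[4]/(2 * 2) -muln2 -muln_modl.
by rewrite muln_eq0 orbF modn2 eqb0.
Qed.

Theorem theorem4p4 (D : digraph) (m n l : nat)
    (hD : eulerian D)
    (hm : #|darc D| = m)
    (hn : #|vertex D| = n)
    (hl : #|[set x : vertex D | degree x == 0 %[mod 4]]| = l) :
  (forall (x : vertex D) (T : seq (darc D)), euler_circuit x T ->
     exists r : {perm dart D},
       [/\ directed_embedding r,
           exists2 F : {set dart D},
             profaces r = [set F] & bounded_clockwise_by r F T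
         & #|antifaces r| <= l + 1])
  /\
  (exists2 g : rat,
     is_max_directed_genus D g
   & ((m%:R - n%:R - l%:R) / 2%:R <= g)%R).
Proof.
rewrite -hl; split; first exact: euler_embedding.
case: hD => x [s /euler_embedding [r [emb [F proF _] antiF]]].
have [g0 emb0 max0] := Order.TotalTheory.arg_maxP (@genus D) emb.
exists (genus g0).
  by split; [exists g0|].
apply: Order.POrderTheory.le_trans (max0 r emb).
(* With at most [1 + (l + 1)] faces, [2 - (n - m + #|faces r|)] is at least [m - n - l]. *)
rewrite /genus /euler_char hm hn Num.Theory.ler_pM2r //.
have := card_faces emb; rewrite proF cards1 => /leq_trans.
move=> /(_ _ (leq_add (leqnn 1) antiF)).
rewrite hl -(Num.Theory.ler_nat rat) !GRing.natrD intrD intrB -!pmulrn; lra.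
Qed.
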